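(* Let $G$ be a locally compact topological group. Then every bounded and closed subset of $G$ is compact. Moreover, if $E\subseteq G$ is bounded, then the closure $E^-$ of $E$ in $G$ is compact.
   Context: For a subset $V$ of a group and a natural number $n\ge 1$, $V^n=\{x_1x_2\cdots x_n : x_i\in V,\ 1\le i\le n\}$. Let $e$ be the identity of the topological group $G$. A subset $E\subseteq G$ is called bounded if for every neighborhood $V$ of $e$ there is a natural number $n$ such that $E\subseteq V^n$. *)

(* Defs.v *)
From HB Require Import structures.
From mathcomp Require Import all_boot.
From mathcomp Require Import all_classical topology.

Set Implicit Arguments.
Unset Strict Implicit.
Unset Printing Implicit Defensive.

Local Open Scope classical_set_scope.
Local Open Scope group_scope.

HB.structure Definition PreTopologicalGroup := {G of Topological G & Group G}.

HB.mixin Record PreTopologicalGroup_isTopologicalGroup G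
    & PreTopologicalGroup G := {
  mulg_continuous : continuous (fun x : G * G => x.1 * x.2) ;
  invg_continuous : continuous (fun x : G => x^-1) ;
}.

(* No separation axiom is assumed. *)
#[short(type="topologicalGroupType")]
HB.structure Definition TopologicalGroup :=
  {G of PreTopologicalGroup G & PreTopologicalGroup_isTopologicalGroup G}.

(* V^n; the product is taken in increasing order of the index. *)
Definition set_expg (G : groupType) (V : set G) (n : nat) : set G :=
  [set x | exists2 f : 'I_n -> G, (forall i, V (f i)) & x = \prod_(i < n) f i].

Definition group_bounded (G : topologicalGroupType) (E : set G) : Prop :=
  forall V : set G, nbhs 1 V -> exists2 n : nat, (0 < n)%N & E `<=` set_expg V n.

(* Main.v *)
(** A compact neighbourhood [K] of the identity has compact powers [K^n], and
    [closure A] is contained in [A * K]; hence a bounded set [E] contained in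
    [K^n] has its closure contained in the compact set [K^(n+1)].  The last
    step avoids using that compact sets are closed, which would need the
    Hausdorff property. *)

Require Import Defs.
From mathcomp Require Import all_boot.
From mathcomp Require Import all_classical topology.

Local Open Scope classical_set_scope.

Lemma set_expg0 (G : groupType) (V : set G) : set_expg V 0 = [set 1%g].
Proof.
apply/seteqP; split=> [x [f _ ->]|x ->]; first by rewrite /= big_ord0.
by exists (fun=> 1%g); [case|rewrite big_ord0].
Qed.

Lemma set_expgS (G : groupType) (V : set G) (n : nat) :
  set_expg V n.+1 = [set (x.1 * x.2)%g | x in set_expg V n `*` V].
Proof.
apply/seteqP; split=> [x [f Vf ->]|_ [[_ y] /= [[f Vf ->] Vy] <-]].
  exists (\prod_(i < n) f (widen_ord (leqnSn n) i), f ord_max)%g.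
    by split=> //=; exists (fun i => f (widen_ord (leqnSn n) i)).
  by rewrite big_ord_recr.
(* The first [n] factors come from [f], and [y] fills the last slot: [unlift ord_max i] is [None]
   exactly when [i] is [ord_max]. *)
exists (fun i => if unlift ord_max i is Some j then f j else y).
  by move=> i; case: unliftP.
rewrite big_ord_recr /= unlift_none; congr (_ * _)%g; apply: eq_bigr => i _.
have -> : widen_ord (leqnSn n) i = lift ord_max i.
  by apply: val_inj; rewrite /= /bump leqNgt ltn_ord.
by rewrite liftK.
Qed.

(** By induction, each power is the image of the compact product of the previous power with [V]
    under the continuous multiplication. *)
Lemma compact_set_expg (G : topologicalGroupType) (V : set G) (n : nat) :
  compact V -> compact (set_expg V n).
Proof.
move=> cptV; elim: n => [|n IHn].
  by rewrite set_expg0; exact: compact_set1.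
rewrite set_expgS; apply: continuous_compact; last exact: compact_setX.
by apply: continuous_subspaceT => z; exact: (@mulg_continuous G).
Qed.

(** For fixed [x], the map sending [y] to [y^-1 * x] is continuous and takes [x] to the identity.
    The preimage of [V] is thus a neighbourhood of [x], so it meets [A] at some [y], and
    [x = y * (y^-1 * x)]. *)
Lemma closure_sub_mulg (G : topologicalGroupType) (A V : set G) :
  nbhs 1%g V -> closure A `<=` [set (x.1 * x.2)%g | x in A `*` V].
Proof.
move=> V1 x clAx.
have : nbhs x [set y | V (y^-1 * x)%g].
  have cvgx : (y^-1 * x)%g @[y --> x] --> (x^-1 * x)%g.
    apply: continuous2_cvg; last exact: cvg_cst.
      exact: (@mulg_continuous G (x^-1%g, x)).
    exact: invg_continuous.
  by apply: cvgx; rewrite mulVg.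
move=> /clAx [y [Ay Vy]]; exists (y, y^-1 * x)%g => //=.
by rewrite mulVKg.
Qed.

Theorem mainTheorem2 (G : topologicalGroupType)
    (lcG : locally_compact [set: G]) :
  (forall E : set G, group_bounded E -> closed E -> compact E) /\
  (forall E : set G, group_bounded E -> compact (closure E)).
Proof.
have cptcl (E : set G) : group_bounded E -> compact (closure E).
  have [K K1 [cptK _]] := lcG 1%g I.
  (* Local compactness is stated with neighbourhoods relative to a subset, here the whole space. *)
  have {}K1 : nbhs 1%g K by rewrite withinET in K1.
  move=> /(_ K K1) [n _ EK].
  apply: (@subclosed_compact _ _ (set_expg K n.+1)).
  - exact: closed_closure.
  - exact: compact_set_expg.
  - rewrite set_expgS; apply: subset_trans (closureS EK) _.
    exact: closure_sub_mulg.
split=> // E bE clE; rewrite (closure_id E).1 //; exact: cptcl.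
Qed.
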